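(* Let $H$ be a Hilbert space, let $\mathcal{L}$ be a commutative subspace lattice on $H$, and let $\mathcal{A}=\mathrm{Alg}\,\mathcal{L}$ be the corresponding CSL algebra. Then $\mathcal{A}$ possesses property (V), that is, for all $x,y\in H$, $$\inf_{L\in \mathrm{Lat}\,\mathcal{A}} \left(\|(I-L)x\|^2 + \|Ly\|^2\right) \leq \|\omega_{x,y}|_{\mathcal{A}}\|.$$
   Context: $\mathcal{B}(H)$ is the algebra of all bounded linear operators on $H$, with identity $I$, and $\mathcal{P}(H)$ is the set of all projections (self-adjoint idempotents) in $\mathcal{B}(H)$, which is a complete lattice in its natural order. A subspace lattice is a sublattice of $\mathcal{P}(H)$ that is closed in the strong operator topology. A commutative subspace lattice (CSL) is a subspace lattice $\mathcal{L}$ such that $PQ=QP$ for all $P,Q\in\mathcal{L}$. For a subspace lattice $\mathcal{L}$, $\mathrm{Alg}\,\mathcal{L}=\{A\in\mathcal{B}(H): (I-L)AL=0 \text{ for all } L\in\mathcal{L}\}$. A CSL algebra is an algebra of the form $\mathrm{Alg}\,\mathcal{L}$ for some CSL $\mathcal{L}$. For a unital operator algebra $\mathcal{A}\subseteq\mathcal{B}(H)$, $\mathrm{Lat}\,\mathcal{A}$ denotes the set of all projections $L\in\mathcal{B}(H)$ with $(I-L)AL=0$ for all $A\in\mathcal{A}$. For $x,y\in H$, $\omega_{x,y}$ is the vector functional on $\mathcal{B}(H)$ given by $\omega_{x,y}(T)=(Tx,y)$, and the norm of its restriction to $\mathcal{A}$ is $\|\omega_{x,y}|_{\mathcal{A}}\|=\sup\{|(Ax,y)|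 : A\in\mathcal{A},\ \|A\|\le 1\}$. A unital operator algebra $\mathcal{A}$ is said to possess property (V) if the displayed inequality holds for all $x,y\in H$. *)

(* Defs.v *)
From HB Require Import structures.
From mathcomp Require Import all_boot all_order all_algebra.
From mathcomp Require Import complex.
From mathcomp Require Import all_classical all_reals all_analysis.

Set Implicit Arguments.
Unset Strict Implicit.
Unset Printing Implicit Defensive.

Import Order.TTheory GRing.Theory Num.Theory.
Import numFieldNormedType.Exports.

Local Open Scope classical_set_scope.
Local Open Scope ring_scope.
Local Open Scope complex_scope.

Definition inner_product_norm (R : realType) (H : normedModType R[i])
    (dot : {dot H for @Num.conj R[i]}) : Prop :=
  forall x : H, `|x| ^+ 2 = dot x x.

(* The norms below take their values in R[i]; since infima and suprema live in
   the real field R, we use their real parts (their imaginary parts vanish). *)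
Definition rnorm (R : realType) (V : normedModType R[i]) (x : V) : R :=
  complex.Re `|x|.

Section OperatorsOnHilbertSpace.
Variables (R : realType) (H : completeNormedModType R[i]).
(* By the convention of {dot H for _}, the form is linear in its first
   argument and conjugate-linear in its second one. *)
Variable dot : {dot H for @Num.conj R[i]}.

(* Operators are functions H -> H, and sets of operators are sets of functions,
   so that equality of operators is pointwise equality. *)
Definition bounded_op : set (H -> H) :=
  [set A | linear A /\ exists M : R, forall x, rnorm (A x) <= M * rnorm x].

Definition opnorm (A : H -> H) : R :=
  sup [set rnorm (A x) | x in [set x | rnorm x <= 1]].

Definition self_adjoint (A : H -> H) : Prop :=
  forall x y, dot (A x) y = dot x (A y).

Definition projection : set (H -> H) :=
  [set P | [/\ bounded_op P, P \o P = P & self_adjoint P]].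

Definition op_le (P Q : H -> H) : Prop :=
  forall x, dot (P x) x <= dot (Q x) x.

Definition is_meet (P Q M : H -> H) : Prop :=
  [/\ projection M, op_le M P, op_le M Q &
      forall N, projection N -> op_le N P -> op_le N Q -> op_le N M].

Definition is_join (P Q J : H -> H) : Prop :=
  [/\ projection J, op_le P J, op_le Q J &
      forall N, projection N -> op_le P N -> op_le Q N -> op_le J N].

Definition sublattice (L : set (H -> H)) : Prop :=
  [/\ L `<=` projection,
      forall P Q, L P -> L Q -> exists2 M, is_meet P Q M & L M &
      forall P Q, L P -> L Q -> exists2 J, is_join P Q J & L J].

(* The strong operator topology is the topology that the set of bounded
   operators inherits from the topology of pointwise norm convergence. *)
Definition SOT_closed (L : set (H -> H)) : Prop :=
  @closed (subspace (bounded_op : set {ptws H -> H})) L.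

Definition subspace_lattice (L : set (H -> H)) : Prop :=
  sublattice L /\ SOT_closed L.

Definition CSL (L : set (H -> H)) : Prop :=
  subspace_lattice L /\ forall P Q, L P -> L Q -> P \o Q = Q \o P.

(* (I - P) A P = 0 *)
Definition leaves_invariant (A P : H -> H) : Prop :=
  (idfun \- P) \o A \o P = cst 0.

Definition Alg (L : set (H -> H)) : set (H -> H) :=
  [set A | bounded_op A /\ forall P, L P -> leaves_invariant A P].

Definition Lat (A : set (H -> H)) : set (H -> H) :=
  [set P | projection P /\ forall T, A T -> leaves_invariant T P].

Definition vector_functional (x y : H) (T : H -> H) : R[i] := dot (T x) y.

Definition restricted_norm (A : set (H -> H)) (f : (H -> H) -> R[i]) : R :=
  sup [set complex.Re `|f T| | T in [set T | A T /\ opnorm T <= 1]].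

Definition property_V (A : set (H -> H)) : Prop :=
  forall x y : H,
    inf [set rnorm (x - P x) ^+ 2 + rnorm (P y) ^+ 2 | P in Lat A]
      <= restricted_norm A (vector_functional x y).

End OperatorsOnHilbertSpace.

(* Main.v *)
(* Finitely many projections in [L] have a common resolution of the identity
   [(E_t)], preordered so that an operator [A] leaves these projections
   invariant iff [E_u A E_t = 0] unless [t <= u]; up-sets of this preorder give
   projections in [Lat (Alg L)].  Regard [|E_t x|^2] as supply and [|E_u y|^2]
   as demand, with shipping from [t] to [u] allowed when [t <= u].  The cut
   defined by an up-set with projection [P] costs [|(I - P) x|^2 + |P y|^2], so
   by max-flow min-cut there is a flow [sigma] of total mass at least the
   infimum [c] in question.  Its pseudo-integral operator
     A z = sum_(t, u) sigma(t, u) (z, E_t x) / |E_t x|^2 E_u y / |E_u y|^2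
   is a contraction, because the marginals of [sigma] are bounded by supply and
   demand; it leaves the given projections invariant, and [(A x, y)] is the mass
   of [sigma].  A weak operator cluster point of these contractions, as the
   finite set grows, lies in [Alg L] and still satisfies [Re (A x, y) >= c]. *)
Require Import Defs.
From mathcomp Require Import all_boot all_order all_algebra finmap.
From mathcomp Require Import complex ring lra.
From mathcomp Require Import all_classical all_reals all_analysis.

Set Implicit Arguments.
Unset Strict Implicit.
Unset Printing Implicit Defensive.

Import Order.TTheory GRing.Theory Num.Theory.
Import numFieldNormedType.Exports.

Local Open Scope ring_scope.

(** * Weighted Hall theorem and max-flow min-cut *)

Section Transport.
Import fintype boot.finset.

Definition neighbours (S T : finType) (e : S -> T -> bool) (U : {set S}) :
  {set T} := [set t | [exists s in U, e s t]].

Lemma neighboursP (S T : finType) (e : S -> T -> bool) (U : {set S}) t :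
  reflect (exists2 s, s \in U & e s t) (t \in neighbours e U).
Proof. by rewrite inE; apply: exists_inP. Qed.

Lemma sum_mask (R : pzRingType) (T : finType) (A B : {set T}) (f : T -> R) :
  \sum_(t in A) (if t \in B then f t else 0) = \sum_(t in A :&: B) f t.
Proof. by rewrite -big_mkcondr /=; apply: eq_bigl => t; rewrite inE. Qed.

Lemma sum_sub_point (R : pzRingType) (T : finType) (A : {set T}) (f : T -> R)
    (i : T) (d : R) :
  \sum_(t in A) (f t - (if t == i then d else 0)) =
  \sum_(t in A) f t - (if i \in A then d else 0).
Proof.
rewrite sumrB -big_mkcondr /=; congr (_ - _); case: ifP => iA.
  by rewrite (big_pred1 i) // => t /=; case: eqP => [->|]; rewrite ?iA ?andbF.
by rewrite big1 // => t /andP[tA /eqP ti]; rewrite ti iA in tA.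
Qed.

(* Halmos--Vaughan: push as much weight as possible along one edge; either an
   endpoint is exhausted or Hall's condition becomes tight for a set [U], and
   the problem splits into its parts on [U] and on the complement of [U]. *)
Lemma weighted_hall (R : realFieldType) (S T : finType) (e : S -> T -> bool)
    (a : S -> R) (b : T -> R) :
  (forall s, 0 <= a s) -> (forall t, 0 <= b t) ->
  (forall U : {set S},
     \sum_(s in U) a s <= \sum_(t in neighbours e U) b t) ->
  exists f : S -> T -> R,
    [/\ forall s t, 0 <= f s t, forall s t, f s t != 0 -> e s t,
        forall s, \sum_t f s t = a s & forall t, \sum_s f s t <= b t].
Proof.
(* Induction on the number of sources with positive supply plus the number of targets with positive
   demand. *)
have [n] := ubnP (#|[set s | (0 < a s)%R]| + #|[set t | (0 < b t)%R]|)%N.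
elim: n a b => // n IHn a b; rewrite ltnS => len a0 b0 hall.
pose N := neighbours e.
have [/existsP[i ai]|/existsPn az] := boolP [exists i, 0 < a i]; last first.
  exists (fun _ _ => 0); split => // [s t||t]; rewrite ?eqxx //.
    by move=> s; rewrite big1 //; apply/esym/le_anti; rewrite a0 leNgt az.
  by rewrite big1.
have [j eij bj] : exists2 j, e i j & 0 < b j.
  have := hall [set i]; rewrite big_set1 => /(lt_le_trans ai) bN.
  apply/exists_inP; apply: contraLR bN => /exists_inPn nj.
  rewrite -leNgt sumr_le0 // => t /neighboursP[s]; rewrite inE => /eqP -> /nj.
  by rewrite -leNgt.
pose slack (U : {set S}) := \sum_(t in N U) b t - \sum_(s in U) a s.
pose sep (U : {set S}) := (i \notin U) && (j \in N U).
(* The largest amount that can be sent from [i] to [j]. Only sets in [sep] lose slack: their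
   neighbours give up [d] of demand while their own supply is unchanged. *)
pose d := \big[Order.min/Order.min (a i) (b j)]_(U | sep U) slack U.
have d0 : 0 <= d.
  rewrite /d; apply: (big_ind (fun x => 0 <= x)); first by rewrite le_min a0 b0.
    by move=> u v u0 v0; rewrite le_min u0.
  by move=> U _; rewrite subr_ge0 hall.
have d_min : d <= Order.min (a i) (b j) by apply: bigmin_le_id.
have [dai dbj] : d <= a i /\ d <= b j by move: d_min; rewrite le_min => /andP.
have d_slack U : sep U -> d <= slack U by move=> sU; apply: bigmin_le_cond.
have d_attained : d = a i \/ d = b j \/ exists2 U, sep U & slack U = d.
  pose K x := x = a i \/ x = b j \/ exists2 U, sep U & slack U = x.
  rewrite -/(K d); apply: (big_ind K).
  - by case: leP => _; [left | right; left].
  - by move=> u v Ku Kv; case: leP.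
  - by move=> U sU; right; right; exists U.
pose a' s := a s - (if s == i then d else 0).
pose b' t := b t - (if t == j then d else 0).
have a'0 s : 0 <= a' s.
  by rewrite /a'; case: eqP => [->|_]; rewrite ?subr_ge0 ?subr0.
have b'0 t : 0 <= b' t.
  by rewrite /b'; case: eqP => [->|_]; rewrite ?subr_ge0 ?subr0.
have hall' (U : {set S}) : \sum_(s in U) a' s <= \sum_(t in N U) b' t.
  rewrite !sum_sub_point; have := hall U; rewrite -/(N U).
  have [iU|iU] := boolP (i \in U).
    have -> : j \in N U by apply/neighboursP; exists i.
    by rewrite lerD2r.
  have [jU _|_] := boolP (j \in N U); last by rewrite !subr0.
  have := d_slack U; rewrite /sep iU jU => /(_ isT).
  by rewrite /slack subr0 lerBrDr lerBrDl.
suff [f [f0 fe fa fb]] : exists f : S -> T -> R,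
    [/\ forall s t, 0 <= f s t, forall s t, f s t != 0 -> e s t,
        forall s, \sum_t f s t = a' s & forall t, \sum_s f s t <= b' t].
  exists (fun s t => f s t + (if (s == i) && (t == j) then d else 0)); split.
  - by move=> s t; rewrite addr_ge0 //; case: ifP.
  - move=> s t; case: ifP => [/andP[/eqP -> /eqP ->]//|_].
    by rewrite addr0; apply: fe.
  - move=> s; rewrite big_split /= fa /a'; case: eqP => [->|_] /=.
      by rewrite -big_mkcond big_pred1_eq subrK.
    by rewrite big1 ?subr0 ?addr0.
  - move=> t; rewrite big_split /=; have := fb t; rewrite /b'.
    case: (t =P j) => [->|_].
      under [X in _ -> _ + X <= _]eq_bigr do rewrite andbT.
      by rewrite -big_mkcond big_pred1_eq lerBrDr.
    under [X in _ -> _ + X <= _]eq_bigr do rewrite andbF.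
    by rewrite big1_eq subr0 addr0.
have suppa : [set s | 0 < a' s] \subset [set s | 0 < a s].
  apply/subsetP => s; rewrite !inE /a' => /lt_le_trans; apply.
  by rewrite gerBl; case: ifP.
have suppb : [set t | 0 < b' t] \subset [set t | 0 < b t].
  apply/subsetP => t; rewrite !inE /b' => /lt_le_trans; apply.
  by rewrite gerBl; case: ifP.
have [ai0|ai0] := eqVneq (a' i) 0.
  apply: IHn => //; apply: leq_trans len; rewrite -addSn.
  rewrite leq_add ?subset_leq_card //.
  by apply/proper_card/properP; split=> //; exists i; rewrite inE ?ai0 ?ltxx.
have [bj0|bj0] := eqVneq (b' j) 0.
  apply: IHn => //; apply: leq_trans len; rewrite -addnS.
  rewrite leq_add ?subset_leq_card //.
  by apply/proper_card/properP; split=> //; exists j; rewrite inE ?bj0 ?ltxx.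
(* Neither endpoint is exhausted, so [d] is the slack of some [U]. Since [i] is outside [U] and [j]
   is in [N U], each half of the split omits a positive weight, and the induction hypothesis applies
   to both. *)
have [U /andP[iU jU] dU] : exists2 U, sep U & slack U = d.
  case: d_attained => [di|[dj|//]].
    by move: ai0; rewrite /a' eqxx di subrr eqxx.
  by move: bj0; rewrite /b' eqxx dj subrr eqxx.
have tight : \sum_(t in N U) b' t = \sum_(s in U) a' s.
  by rewrite !sum_sub_point jU (negbTE iU) -dU /slack subr0 subKr.
pose r (T' : finType) (V : {set T'}) (g : T' -> R) t :=
  if t \in V then g t else 0.
have r0 (T' : finType) (V : {set T'}) (g : T' -> R) :
    (forall t, 0 <= g t) -> forall t, 0 <= r T' V g t.
  by move=> g0 t; rewrite /r; case: ifP.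
have rsub (T' : finType) (V : {set T'}) (g : T' -> R) :
    [set t | 0 < r T' V g t] \subset [set t | 0 < g t].
  by apply/subsetP => t; rewrite !inE /r; case: ifP; rewrite ?ltxx.
have i_a' : 0 < a' i by rewrite lt_def ai0 a'0.
have j_b' : 0 < b' j by rewrite lt_def bj0 b'0.
have [f1 [f10 f1e f1a f1b]] : exists f : S -> T -> R,
    [/\ forall s t, 0 <= f s t, forall s t, f s t != 0 -> e s t,
        forall s, \sum_t f s t = r S U a' s
      & forall t, \sum_s f s t <= r T (N U) b' t].
  apply: IHn; [|exact: r0|exact: r0|].
    apply: leq_trans len; rewrite -addSn leq_add //; last first.
      exact/subset_leq_card/(subset_trans _ suppb).
    apply/proper_card/properP; split; first exact: subset_trans suppa.
    by exists i; rewrite inE // /r (negbTE iU) ltxx.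
  move=> V; rewrite !sum_mask; apply: le_trans (hall' (V :&: U)) _.
  have sub : N (V :&: U) \subset N V :&: N U.
    apply/subsetP => t /neighboursP[s /setIP[sV sU] est].
    by rewrite inE; apply/andP; split; apply/neighboursP; exists s.
  by rewrite [leRHS](big_setID (N (V :&: U))) /= (setIidPr sub) lerDl sumr_ge0.
have [f2 [f20 f2e f2a f2b]] : exists f : S -> T -> R,
    [/\ forall s t, 0 <= f s t, forall s t, f s t != 0 -> e s t,
        forall s, \sum_t f s t = r S (~: U) a' s
      & forall t, \sum_s f s t <= r T (~: N U) b' t].
  apply: IHn; [|exact: r0|exact: r0|].
    apply: leq_trans len; rewrite -addnS leq_add //.
      exact/subset_leq_card/(subset_trans _ suppa).
    apply/proper_card/properP; split; first exact: subset_trans suppb.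
    by exists j; rewrite inE // /r inE jU ltxx.
  move=> V; rewrite !sum_mask -!setDE.
  (* Subtracting the equality [tight] from Hall's condition for the union leaves the condition for
     the part of [V] outside [U]. *)
  have := hall' (U :|: V).
  rewrite (big_setID U) /= setUK setDUl setDv set0U.
  have sub : N U \subset N (U :|: V).
    apply/subsetP => t /neighboursP[s sU est].
    by apply/neighboursP; exists s; rewrite ?inE ?sU.
  rewrite [leRHS](big_setID (N U)) /= (setIidPr sub).
  rewrite tight lerD2l => /le_trans; apply; rewrite le_eqVlt; apply/orP; left.
  apply/eqP/eq_bigl => t; rewrite !inE.
  case: (boolP [exists s in U, e s t]) => //= tU.
  apply/exists_inP/exists_inP => -[s sUV est]; exists s => //;
    last by rewrite inE sUV orbT.
  move: sUV; rewrite inE => /orP[sU|//].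
  by case/exists_inP: tU; exists s.
exists (fun s t => f1 s t + f2 s t); split.
- by move=> s t; rewrite addr_ge0.
- move=> s t; have [f1z|/f1e//] := eqVneq (f1 s t) 0.
  by rewrite f1z add0r; apply: f2e.
- move=> s; rewrite big_split /= f1a f2a /r in_setC.
  by case: (s \in U); rewrite ?addr0 ?add0r.
- move=> t; rewrite big_split /=; apply: le_trans (lerD (f1b t) (f2b t)) _.
  by rewrite /r in_setC; case: (t \in N U); rewrite ?addr0 ?add0r.
Qed.

(* Max-flow min-cut: a dummy sink adjacent to every source absorbs the part of
   the supply that cannot be shipped, reducing it to Hall's condition. *)
Lemma transport_min_cut (R : realFieldType) (S T : finType) (e : S -> T -> bool)
    (a : S -> R) (b : T -> R) (c : R) :
  (forall s, 0 <= a s) -> (forall t, 0 <= b t) ->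
  (forall U : {set S},
     c <= \sum_(s in ~: U) a s + \sum_(t in neighbours e U) b t) ->
  exists f : S -> T -> R,
    [/\ forall s t, 0 <= f s t, forall s t, f s t != 0 -> e s t,
        forall s, \sum_t f s t <= a s, forall t, \sum_s f s t <= b t
      & c <= \sum_s \sum_t f s t].
Proof.
move=> a0 b0 cut.
have neigh0 : neighbours e set0 = set0.
  apply/setP => t; rewrite inE [RHS]inE.
  by apply/exists_inP => -[s]; rewrite inE.
pose e' s (t : T + unit) := if t is inl t' then e s t' else true.
pose b' (t : T + unit) := if t is inl t' then b t' else \sum_s a s - c.
(* The cut of the empty set shows that the demand of the dummy sink is nonnegative. *)
have c_le : c <= \sum_s a s.
  have := cut set0; rewrite neigh0 big_set0 addr0 setC0.
  by under eq_bigl do rewrite inE.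
have [||U|f [f0 fe fa fb]] := @weighted_hall R S (T + unit)%type e' a b'.
- by [].
- by case=> //= _; rewrite subr_ge0.
(* A nonempty [U] has the dummy sink as a neighbour, which turns Hall's condition into the cut
   inequality. *)
- have [->|[s0 s0U]] := set_0Vmem U.
    by rewrite big_set0 sumr_ge0 // => -[t|_] _ //=; rewrite subr_ge0.
  rewrite [leRHS]big_sumType /=.
  rewrite (eq_bigl (mem (neighbours e U))) => [|t]; last by rewrite !inE.
  rewrite (big_pred1 tt) => [|[]]; last first.
    by rewrite /= eqxx; apply/neighboursP; exists s0.
  rewrite [X in _ + (X - c)](bigID (mem U)) /=.
  have <- : \sum_(s in ~: U) a s = \sum_(s | s \notin U) a s.
    by apply: eq_bigl => s; rewrite in_setC.
  have := cut U; lra.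
exists (fun s t => f s (inl t)); split => //.
- by move=> s t; apply: fe.
- by move=> s; rewrite -(fa s) big_sumType /= lerDl sumr_ge0.
have -> : \sum_s \sum_t f s (inl t) = \sum_s a s - \sum_s f s (inr tt).
  rewrite -sumrB; apply: eq_bigr => s _.
  rewrite -(fa s) big_sumType /= (big_pred1 tt) ?addrK //; by case.
by have /= := fb (inr tt); lra.
Qed.

End Transport.

Local Open Scope classical_set_scope.
Local Open Scope complex_scope.

(** * Inner products and the Riesz representation *)

Section InnerProduct.
Variables (R : realType) (H : completeNormedModType R[i]).
Variables (dot : {dot H for @Num.conj R[i]}) (dotE : inner_product_norm dot).

(** A real inner product with the same norm, so that limits are taken in [R]; complex linearity is
    recovered through [rdot_scale]. *)
Definition rdot (a b : H) : R := complex.Re (dot a b).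

Lemma dotC a b : dot a b = (dot b a)^*.
Proof. by rewrite (hermC dot a b) expr0 mul1r. Qed.

Lemma dotDl a b c : dot (a + b) c = dot a c + dot b c.
Proof. exact: linearDl. Qed.
Lemma dotZl k a c : dot (k *: a) c = k * dot a c.
Proof. exact: linearZl_LR. Qed.
Lemma dot0l c : dot 0 c = 0. Proof. exact: linear0l. Qed.
Lemma dotZr k a c : dot c (k *: a) = k^* * dot c a.
Proof. exact: linearZr_LR. Qed.
Lemma dotBl a b c : dot (a - b) c = dot a c - dot b c.
Proof. exact: linearBl. Qed.
Lemma dotBr a b c : dot c (a - b) = dot c a - dot c b.
Proof. exact: linearBr. Qed.

Lemma rdotC a b : rdot a b = rdot b a.
Proof. by rewrite /rdot dotC; case: (dot b a). Qed.

Lemma rdotDl a b c : rdot (a + b) c = rdot a c + rdot b c.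
Proof. by rewrite /rdot dotDl; case: (dot a c); case: (dot b c). Qed.

Lemma rdotBl a b c : rdot (a - b) c = rdot a c - rdot b c.
Proof. by rewrite /rdot dotBl; case: (dot a c); case: (dot b c). Qed.

Lemma rdotDr a b c : rdot c (a + b) = rdot c a + rdot c b.
Proof. by rewrite !(rdotC c) rdotDl. Qed.

Lemma rdotBr a b c : rdot c (a - b) = rdot c a - rdot c b.
Proof. by rewrite !(rdotC c) rdotBl. Qed.

Lemma rdot0l c : rdot 0 c = 0.
Proof. by rewrite /rdot dot0l. Qed.

Lemma rdot0r c : rdot c 0 = 0.
Proof. by rewrite rdotC rdot0l. Qed.

Lemma rdotZl (k : R) a c : rdot (k%:C *: a) c = k * rdot a c.
Proof.
by rewrite /rdot dotZl; case: (dot a c) => u v /=; rewrite mul0r subr0.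
Qed.

Lemma rdotZr (k : R) a c : rdot c (k%:C *: a) = k * rdot c a.
Proof. by rewrite !(rdotC c) rdotZl. Qed.

Lemma rdot_scale (k : R[i]) a b : rdot (k *: a) b = rdot a (k^* *: b).
Proof. by rewrite /rdot dotZl dotZr conjCK. Qed.

Lemma rdot_suml (I : finType) (P : pred I) (F : I -> H) c :
  rdot (\sum_(i | P i) F i) c = \sum_(i | P i) rdot (F i) c.
Proof.
by apply: (big_morph (rdot^~ c)) => [? ?|]; [exact: rdotDl|exact: rdot0l].
Qed.

Lemma rnorm_ge0 (a : H) : 0 <= rnorm a.
Proof. by have := normr_ge0 a; rewrite lecE => /andP[_]. Qed.

Lemma rnormC (a : H) : `|a| = (rnorm a)%:C.
Proof. by rewrite /rnorm RRe_real // ger0_real. Qed.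

Lemma dotxx a : dot a a = (rdot a a)%:C.
Proof. by rewrite /rdot -dotE rnormC -rmorphXn. Qed.

Lemma rnorm2 (a : H) : rnorm a ^+ 2 = rdot a a.
Proof. by rewrite /rdot -dotE rnormC -rmorphXn. Qed.

Lemma rdot_ge0 a : 0 <= rdot a a.
Proof. by rewrite -rnorm2 sqr_ge0. Qed.

Lemma rdot_eq0 a : rdot a a = 0 -> a = 0.
Proof.
move=> a0; apply/eqP.
by rewrite -normr_eq0 rnormC -sqrf_eq0 -rmorphXn /= rnorm2 a0.
Qed.

Lemma rdot_inj a a' : (forall b, rdot a b = rdot a' b) -> a = a'.
Proof. by move=> h; apply/subr0_eq/rdot_eq0; rewrite rdotBl h subrr. Qed.

Definition abs2 (z : R[i]) : R := complex.Re z ^+ 2 + complex.Im z ^+ 2.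

Lemma abs2_ge0 z : 0 <= abs2 z.
Proof. by rewrite addr_ge0 ?sqr_ge0. Qed.

(** Expand [|k z - l conj w|^2 >= 0]. *)
Lemma ReM_le (k l : R) (z w : R[i]) :
  k * l * complex.Re (z * w) <= (k ^+ 2 * abs2 z + l ^+ 2 * abs2 w) / 2.
Proof.
case: z w => [a b] [c d]; rewrite /abs2 /=.
have := sqr_ge0 (k * a - l * c); have := sqr_ge0 (k * b + l * d); nra.
Qed.

Lemma dot_CauchySchwarz a b : abs2 (dot a b) <= rdot a a * rdot b b.
Proof.
have [b0|b0] := eqVneq (rdot b b) 0.
  by rewrite (rdot_eq0 b0) dotC dot0l rdot0l mulr0 /abs2 /= oppr0 expr0n addr0.
have b_gt0 : 0 < rdot b b by rewrite lt_def b0 rdot_ge0.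
have := rdot_ge0 ((rdot b b)%:C *: a - dot a b *: b).
rewrite /rdot !(dotBl, dotBr, dotZl, dotZr) (dotC b a) !dotxx /=.
rewrite -/(rdot _ _) /abs2.
case: (dot a b) => u v /=; rewrite !(mul0r, mulr0, subr0, addr0, oppr0).
nra.
Qed.

Lemma rdot_CauchySchwarz a b : `|rdot a b| <= rnorm a * rnorm b.
Proof.
rewrite -ler_sqr ?nnegrE ?mulr_ge0 ?rnorm_ge0 //.
rewrite exprMn !rnorm2 real_normK ?num_real //.
by apply: le_trans (dot_CauchySchwarz a b); rewrite lerDl sqr_ge0.
Qed.

Lemma abs2_normr (z : R[i]) : complex.Re `|z| ^+ 2 = abs2 z.
Proof. by rewrite normc_def /= sqr_sqrtr // abs2_ge0. Qed.

Lemma normr_dot_le a b : complex.Re `|dot a b| <= rnorm a * rnorm b.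
Proof.
rewrite -ler_sqr ?nnegrE ?mulr_ge0 ?rnorm_ge0 //.
  by rewrite exprMn !rnorm2 abs2_normr dot_CauchySchwarz.
by rewrite normc_def sqrtr_ge0.
Qed.

End InnerProduct.

Section Riesz.
Variables (R : realType) (H : completeNormedModType R[i]).
Variables (dot : {dot H for @Num.conj R[i]}) (dotE : inner_product_norm dot).

(* The minimizing filter of [|b|^2 - 2 phi b] is Cauchy by the parallelogram
   identity, and at its limit the first variation vanishes. *)
Lemma riesz_representation (phi : H -> R) (M : R) :
  (forall a b, phi (a + b) = phi a + phi b) ->
  (forall (k : R) a, phi (k%:C *: a) = k * phi a) ->
  (forall a, `|phi a| <= M * rnorm a) ->
  exists z, forall b, phi b = rdot dot z b.
Proof.
move=> phiD phiZ phi_le.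
pose J b := rdot dot b b - 2 * phi b.
have J_ge b : - M ^+ 2 <= J b.
  have := phi_le b; have := ler_norm (phi b); rewrite /J -(rnorm2 dotE).
  have := sqr_ge0 (rnorm b - M); nra.
pose m := inf (range J).
have Jinf : has_inf (range J).
  by split; [exists (J 0), 0 | exists (- M ^+ 2) => _ [b _ <-]].
have m_le b : m <= J b by apply: ge_inf; [exact: Jinf.2 | exists b].
have m_adh e : 0 < e -> exists b, J b < m + e.
  by move=> e0; have [_ [b _ <-] ?] := inf_adherent e0 Jinf; exists b.
have close b b' e : J b < m + e -> J b' < m + e -> rnorm (b - b') ^+ 2 <= 4 * e.
  move=> Jb Jb'; have := m_le ((2^-1 : R)%:C *: (b + b')).
  rewrite (rnorm2 dotE); move: Jb Jb'.
  rewrite /J !(rdotBl, rdotBr) !(rdotZl, rdotZr, rdotDl, rdotDr, phiZ, phiD).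
  rewrite (rdotC dot b' b); lra.
(* Along the line through [b] in direction [h], the minimum of [J] lies
   [(rdot b h - phi h)^2 / |h|^2] below [J b], and this drop is less than [e]. *)
have variation b e h : J b < m + e ->
    (rdot dot b h - phi h) ^+ 2 <= e * rnorm h ^+ 2.
  move=> Jb; have := m_le b; rewrite (rnorm2 dotE).
  have [h0|h0] := eqVneq (rdot dot h h) 0.
    have -> : h = 0 by apply: (rdot_eq0 dotE).
    have := phiZ 0 0; rewrite scaler0 mul0r => ->.
    by rewrite !rdot0r subr0 expr0n /= mulr0.
  have h_gt0 : 0 < rdot dot h h by rewrite lt_def h0 rdot_ge0.
  have := m_le (b + (- (rdot dot b h - phi h) / rdot dot h h)%:C *: h).
  move: Jb; rewrite /J !(rdotZl, rdotZr, rdotDl, rdotDr, phiZ, phiD).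
  rewrite (rdotC dot h b); move: (rdot dot h h) h_gt0 {h0} => B B0.
  move: (rdot dot b b) (rdot dot b h) (phi h) (phi b) => x y p q Jb Jm _.
  rewrite -ler_pdivrMr //.
  have : (y - p) ^+ 2 / B =
      - (2 * (- (y - p) / B * y) + (- (y - p) / B * (- (y - p) / B * B))
         - 2 * (- (y - p) / B * p)).
    by field; rewrite gt_eqF.
  lra.
pose F := filter_from [set e : R | 0 < e] (fun e => [set b | J b < m + e]).
have FF : ProperFilter F.
  apply: filter_from_proper => [|e /= /m_adh[b]]; last by exists b.
  apply: filter_from_filter; first by exists 1 => /=.
  move=> e e' /= e0 e0'; exists (Order.min e e'); first by rewrite /= lt_min e0.
  by move=> b /=; rewrite -ltrBlDl lt_min !ltrBlDl => /andP[].
have /cauchy_cvgP Fcvg : cauchy F.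
  apply: cauchy_exP => eps; rewrite ltcE /= => /andP[/eqP eps0 r0].
  (* With this tolerance [close] bounds squared distances by [eps^2 / 2]. *)
  have e0 : 0 < complex.Re eps ^+ 2 / 8 by rewrite divr_gt0 ?exprn_gt0.
  have [b Jb] := m_adh _ e0; exists b; exists (complex.Re eps ^+ 2 / 8) => //.
  move=> b' /= Jb'; rewrite -ball_normE /= rnormC ltcE /= -eps0 eqxx /=.
  rewrite -ltr_sqr ?nnegrE ?rnorm_ge0 ?ltW //.
  by apply: le_lt_trans (close _ _ _ Jb Jb') _; nra.
pose z := lim F.
have near_z (e : R) : 0 < e -> exists2 b, J b < m + e & rnorm (b - z) < e.
  move=> e0.
  have Fe : F (ball z e%:C).
    by apply: Fcvg; apply: nbhsx_ballx; rewrite ltcR.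
  have /filter_ex[b []] : F ([set b | J b < m + e] `&` ball z e%:C).
    by apply: filterI => //; exists e.
  rewrite -ball_normE /= distrC rnormC ltcR; by exists b.
exists z => h; apply/esym/eqP; rewrite -subr_eq0 -normr_le0 leNgt.
apply/negP; set D := `|_| => D0.
have h1 : 0 < rnorm h + 1 by rewrite ltr_wpDl ?rnorm_ge0.
(* The second bound gives [2 * eta * |h| < D], the final contradiction; [eta <= 1] lets the
   tolerance [eta ^+ 2] also serve as a distance at most [eta]. *)
pose eta := Order.min 1 (D / (4 * (rnorm h + 1))).
have eta0 : 0 < eta by rewrite lt_min ltr01 divr_gt0 // mulr_gt0.
have [b Jb bz] := near_z (eta ^+ 2) (exprn_gt0 _ eta0).
have c_le : `|rdot dot b h - phi h| <= eta * rnorm h.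
  rewrite -ler_sqr ?nnegrE ?mulr_ge0 ?rnorm_ge0 ?(ltW eta0) //.
  by rewrite real_normK ?num_real // exprMn variation.
have bz_le : `|rdot dot (b - z) h| <= eta * rnorm h.
  apply: le_trans (rdot_CauchySchwarz dotE _ _) _.
  rewrite ler_wpM2r ?rnorm_ge0 //.
  have eta1 : eta <= 1 by rewrite ge_min lexx.
  by move: (ltW bz); nra.
have D_le : D <= eta * rnorm h + eta * rnorm h.
  have -> : D = `|(rdot dot b h - phi h) - rdot dot (b - z) h|.
    by rewrite /D rdotBl; congr `|_|; ring.
  exact: le_trans (ler_normB _ _) (lerD c_le bz_le).
have : eta * (4 * (rnorm h + 1)) <= D.
  by rewrite -ler_pdivlMr ?mulr_gt0 // ge_min lexx orbT.
by have := rnorm_ge0 h; nra.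
Qed.
End Riesz.

(** * Weak operator limits *)

(** If the preimage of a member of a finer filter were not in [U], its complement would be, and the
    finer filter would contain two disjoint sets. *)
Lemma fmap_ultra (T V : Type) (f : T -> V) (U : set_system T) :
  UltraFilter U -> UltraFilter (f @ U).
Proof.
move=> UU; split; first exact: fmap_proper_filter.
move=> G GF sG; rewrite eqEsubset; split=> // A GA.
have [//|UnA] := in_ultra_setVsetC (f @^-1` A) UU.
by have /filter_ex[z []] : G (A `&` ~` A) by apply: filterI => //; exact: sG.
Qed.

Section WeakLimit.
Variables (R : realType) (H : completeNormedModType R[i]).
Variables (dot : {dot H for @Num.conj R[i]}) (dotE : inner_product_norm dot).

Definition contraction : set (H -> H) :=
  [set A | linear A /\ forall a, rnorm (A a) <= rnorm a].

(** Carries identities valid for [U]-almost all operators over to their weak limit. *)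
Lemma near_lim_unique (T : Type) (U : set_system T) {FU : ProperFilter U}
    (f g : T -> R) (l l' : R) (D : set T) :
  U D -> f t @[t --> U] --> l -> g t @[t --> U] --> l' ->
  (forall t, D t -> f t = g t) -> l = l'.
Proof.
move=> UD fl gl fg.
apply: (@cvg_unique _ (@Rhausdorff R) (g t @[t --> U])) => //.
by apply: cvg_trans fl; apply: near_eq_cvg; apply: filterS UD => t /fg.
Qed.

(** For contractions [T] the numbers [rdot (T a) b] stay in a compact interval, so they converge
    along an ultrafilter. The limit is a bounded real functional of [b], which the Riesz theorem
    represents by a vector [A a]. *)
Lemma contraction_weak_limit (U : set_system (H -> H)) :
  UltraFilter U -> U contraction ->
  exists2 A, contraction A &
    forall a b, rdot dot (T a) b @[T --> U] --> rdot dot (A a) b.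
Proof.
move=> UU Uc.
have limit_ex a b : exists2 l : R, `|l| <= rnorm a * rnorm b &
    rdot dot (T a) b @[T --> U] --> l.
  set M := rnorm a * rnorm b.
  have := @segment_compact R (- M) M; rewrite compact_ultra => cpt.
  have [|l [/= + Tl]] := cpt _ (fmap_ultra (fun T => rdot dot (T a) b) UU).
    apply: (@filterS _ U _ contraction) => [T [_ Ta]|]; last exact: Uc.
    rewrite /= in_itv /= -ler_norml.
    apply: le_trans (rdot_CauchySchwarz dotE _ _) _.
    by rewrite ler_wpM2r ?rnorm_ge0.
  by rewrite in_itv /= -ler_norml => lM; exists l.
have [phi phiP] : exists phi : H -> H -> R, forall a b,
    `|phi a b| <= rnorm a * rnorm b /\ rdot dot (T a) b @[T --> U] --> phi a b.
  have lim_ex (p : H * H) : exists l : R, `|l| <= rnorm p.1 * rnorm p.2 /\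
      rdot dot (T p.1) p.2 @[T --> U] --> l.
    by have [l] := limit_ex p.1 p.2; exists l.
  have [phi phiP] := choice lim_ex.
  by exists (fun a b => phi (a, b)) => a b; exact: (phiP (a, b)).
have riesz a : exists z, forall b, phi a b = rdot dot z b.
  apply: (@riesz_representation _ _ dot dotE _ (rnorm a)).
  - move=> b b'; apply: (near_lim_unique Uc (phiP a (b + b')).2
      (cvgD (phiP a b).2 (phiP a b').2)).
    by move=> T _ /=; rewrite rdotDr.
  - move=> k b; apply: (near_lim_unique Uc (phiP a (k%:C *: b)).2
      (cvgM (cvg_cst k) (phiP a b).2)).
    by move=> T _ /=; rewrite rdotZr.
  - by move=> b; apply: (phiP a b).1.
have [A AP] := choice riesz.
have A_lim a b : rdot dot (T a) b @[T --> U] --> rdot dot (A a) b.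
  by rewrite -AP; apply: (phiP a b).2.
exists A => //; split.
  move=> k a a'; apply: (rdot_inj dotE (dot := dot)) => b.
  rewrite rdotDl rdot_scale.
  apply: (near_lim_unique Uc (A_lim _ _) (cvgD (A_lim a _) (A_lim a' b))).
  move=> T [Tlin _].
  by rewrite /= Tlin rdotDl rdot_scale.
(* Testing the form at [b = A a] gives [|A a|^2 <= |a| |A a|]. *)
move=> a; have := (phiP a (A a)).1; rewrite AP -(rnorm2 dotE).
have := rnorm_ge0 (A a); rewrite le_eqVlt => /orP[/eqP <-|A0].
  by rewrite rnorm_ge0.
by rewrite ger0_norm ?sqr_ge0 // expr2 ler_pM2r.
Qed.

Lemma leaves_invariantP (A P : H -> H) :
  leaves_invariant A P <-> forall a, P (A (P a)) = A (P a).
Proof.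
split=> [AP a|AP]; last by apply/funext => a /=; rewrite AP subrr.
by have /(congr1 (@^~ a))/subr0_eq/esym := AP.
Qed.

(* Any ultrafilter finer than the filter of finite subsets of [L] selects a weak
   limit of the contractions obtained for these subsets. *)
Lemma contraction_in_Alg (L : set (H -> H)) (x y : H) (c : R) :
  (forall P, L P -> linear P /\ self_adjoint dot P) -> L idfun ->
  (forall s : seq (H -> H), (forall P, P \in s -> L P) ->
     exists A, [/\ contraction A, c <= rdot dot (A x) y &
                   forall P, P \in s -> leaves_invariant A P]) ->
  exists A, [/\ contraction A, c <= rdot dot (A x) y & Alg L A].
Proof.
move=> L_proj L_id fin.
pose f P : set (H -> H) :=
  [set A | [/\ contraction A, c <= rdot dot (A x) y & leaves_invariant A P]].
have fin_f : finI L f.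
  move=> D DL.
  have [P /DL /set_mem //|A [Ac Axy Ainv]] := fin (finmap.enum_fset D).
  by exists A => P PD; split => //; apply: Ainv.
have FF := finI_filter fin_f.
have [U [UU FU]] := ultraFilterLemma FF.
have Uf P : L P -> U (f P).
  by move=> LP; apply: FU; exists (f P) => //; apply: finI_from1.
have Uc : U contraction by apply: filterS (Uf _ L_id) => A [].
have [A Ac A_lim] := contraction_weak_limit UU Uc.
exists A; split => //.
  apply: (closed_cvg _ (@closed_ge R c) _ _ (A_lim x y)).
  by apply: filterS (Uf _ L_id) => T [].
split.
  by split; [exact: Ac.1 | exists 1 => a; rewrite mul1r; exact: Ac.2].
move=> P LP; apply/leaves_invariantP => a; apply: (rdot_inj dotE) => b.
have [_ P_sa] := L_proj P LP.
(* Self-adjointness moves the outer [P] onto [b], so both sides become weak limits of matrix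
   coefficients of [T]. *)
have -> : rdot dot (P (A (P a))) b = rdot dot (A (P a)) (P b).
  by rewrite /rdot P_sa.
apply: (near_lim_unique (Uf P LP) (A_lim _ _) (A_lim _ _)).
move=> T [_ _ /leaves_invariantP TP].
by rewrite /rdot -P_sa TP.
Qed.
End WeakLimit.

(** * Finitely many commuting projections *)

Section FiniteStep.
Variables (R : realType) (H : completeNormedModType R[i]).
Variables (dot : {dot H for @Num.conj R[i]}) (dotE : inner_product_norm dot).

Lemma linear_map0 (A : H -> H) : linear A -> A 0 = 0.
Proof.
by move=> Alin; have := Alin (-1) 0 0; rewrite scaler0 addr0 scaleN1r addNr.
Qed.

Lemma linear_mapD (A : H -> H) : linear A -> {morph A : a b / a + b}.
Proof. by move=> Alin a b; have := Alin 1 a b; rewrite !scale1r. Qed.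

Lemma linear_mapZ (A : H -> H) : linear A -> forall k a, A (k *: a) = k *: A a.
Proof.
by move=> Alin k a; have := Alin k a 0; rewrite (linear_map0 Alin) !addr0.
Qed.

Lemma linear_mapB (A : H -> H) : linear A -> {morph A : a b / a - b}.
Proof.
by move=> Alin a b; rewrite -scaleN1r addrC Alin scaleN1r addrC.
Qed.

Lemma linear_map_sum (A : H -> H) (I : finType) (D : pred I) (F : I -> H) :
  linear A -> A (\sum_(i | D i) F i) = \sum_(i | D i) A (F i).
Proof.
by move=> Alin; apply: (big_morph A (linear_mapD Alin) (linear_map0 Alin)).
Qed.

Lemma linear_sum_maps (I : finType) (D : pred I) (E : I -> H -> H) :
  (forall i, linear (E i)) -> linear (fun a => \sum_(i | D i) E i a).
Proof.
move=> Elin k a b; rewrite scaler_sumr -big_split /=.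
by apply: eq_bigr => i _; apply: Elin.
Qed.

(** A finite family of orthogonal projections with sum the identity; [res_mul] joins idempotence and
    mutual orthogonality. Some members may be zero. *)
Record resolution (T : finType) (E : T -> H -> H) : Prop := Resolution {
  res_linear : forall t, linear (E t);
  res_adjoint : forall t, self_adjoint dot (E t);
  res_mul : forall t u a, E t (E u a) = if t == u then E t a else 0;
  res_sum : forall a, \sum_t E t a = a }.

(** Induction on [s]: a new [P] splits every [E t] into [P E_t] and [(I - P) E_t]. Commutation with
    all of [L], not just with [s], keeps the induction going. *)
Lemma joint_resolution (L : set (H -> H)) (s : seq (H -> H)) :
  (forall P, L P -> projection dot P) ->
  (forall P Q, L P -> L Q -> P \o Q = Q \o P) ->
  (forall P, P \in s -> L P) ->
  exists (T : finType) (E : T -> H -> H),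
    [/\ resolution E,
        forall P t a, L P -> P (E t a) = E t (P a) &
        forall P t, P \in s ->
          (forall a, P (E t a) = E t a) \/ (forall a, P (E t a) = 0)].
Proof.
move=> Lproj Lcomm; elim: s => [_|P s IHs sL].
  exists unit, (fun _ a => a); split => //; split => //.
  - by move=> a; rewrite (big_pred1 tt) // => -[].
have [T [E [[Elin Eadj Emul Esum] EL Es]]] :
  exists (T : finType) (E : T -> H -> H),
    [/\ resolution E, forall P t a, L P -> P (E t a) = E t (P a) &
        forall P t, P \in s ->
          (forall a, P (E t a) = E t a) \/ (forall a, P (E t a) = 0)].
  by apply: IHs => Q Qs; apply: sL; rewrite inE Qs orbT.
have LP : L P by apply: sL; rewrite mem_head.
have [[Plin _] PP Padj] := Lproj P LP.
have EP t b : E t (P b) = P (E t b) by rewrite EL.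
have PK a : P (P a) = P a by have /(congr1 (@^~ a)) := PP.
pose E' (p : T * bool) a := if p.2 then P (E p.1 a) else E p.1 a - P (E p.1 a).
exists (T * bool)%type, E'; split.
- split.
  + move=> [t [|]] k a b; rewrite /E' /= !Elin !Plin // scalerBr.
    by rewrite opprD addrACA.
  + move=> [t [|]] a b; rewrite /E' /= ?dotBl ?dotBr.
      by rewrite Padj Eadj EL.
    by rewrite Padj !Eadj EL.
  + move=> [t i] [u j] a; rewrite xpair_eqE; case: eqP => [<-|/eqP tu] /=.
      case: i j => [] [] /=; rewrite /E' /= ?(linear_mapB Plin);
        rewrite ?(linear_mapB (Elin t)) ?EP !Emul eqxx;
        by rewrite ?(linear_mapB Plin) ?PK ?subrr ?subr0.
    case: i j => [] [] /=; rewrite /E' /= ?(linear_mapB Plin);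
      rewrite ?(linear_mapB (Elin t)) ?EP !Emul (negbTE tu);
      by rewrite ?(linear_map0 Plin) ?subrr ?(linear_map0 Plin) ?subrr.
  + move=> a; rewrite -(pair_bigA _ (fun t i => E' (t, i) a)) /= -[RHS]Esum.
    by apply: eq_bigr => t _; rewrite big_bool /E' /= addrC subrK.
- move=> Q [t i] a LQ; have [[Qlin _] _ _] := Lproj Q LQ.
  have QP b : Q (P b) = P (Q b) by have /(congr1 (@^~ b)) := Lcomm Q P LQ LP.
  have EQ b : Q (E t b) = E t (Q b) by apply: EL.
  by rewrite /E' /=; case: i; rewrite ?(linear_mapB Qlin) ?QP ?EQ.
move=> Q [t i]; rewrite inE => /orP[/eqP ->|Qs].
  rewrite /E' /=; case: i; [left|right] => a; first by rewrite PK.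
  by rewrite (linear_mapB Plin) PK subrr.
have LQ : L Q by apply: sL; rewrite inE Qs orbT.
have [[Qlin _] _ _] := Lproj Q LQ.
have QP b : Q (P b) = P (Q b) by have /(congr1 (@^~ b)) := Lcomm Q P LQ LP.
have [Qt|Qt] := Es Q t Qs; [left|right] => a; rewrite /E' /=; case: i;
  by rewrite ?(linear_mapB Qlin) ?QP Qt ?(linear_map0 Plin) ?subrr.
Qed.

(** * Projections and preorder attached to a resolution of the identity *)

Section Resolution.
Variables (T : finType) (E : T -> H -> H).
Hypothesis Eres : resolution E.

Lemma dot_res t a b : dot (E t a) b = dot (E t a) (E t b).
Proof. by rewrite -(res_adjoint Eres) (res_mul Eres) eqxx. Qed.

Lemma dot_res_swap t a b : dot a (E t b) = dot (E t a) (E t b).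
Proof. by rewrite -dot_res (res_adjoint Eres). Qed.

Definition part (V : {set T}) (a : H) : H := \sum_(t in V) E t a.

Lemma res_part t (V : {set T}) a :
  E t (part V a) = if t \in V then E t a else 0.
Proof.
rewrite (linear_map_sum _ _ (res_linear Eres t)).
have [tV|tV] := boolP (t \in V).
  rewrite (bigD1 t) //= (res_mul Eres) eqxx big1 ?addr0 // => u /andP[_ ut].
  by rewrite (res_mul Eres) eq_sym (negbTE ut).
rewrite big1 // => u uV; rewrite (res_mul Eres).
by case: eqP => // tu; rewrite tu uV in tV.
Qed.

Lemma partC (V : {set T}) a : a - part V a = part (~: V) a.
Proof.
rewrite -[X in X - _](res_sum Eres) (bigID (mem V)) /= /part addrAC subrr add0r.
by apply: eq_bigl => t; rewrite finset.in_setC.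
Qed.

Lemma part_idem (V : {set T}) a : part V (part V a) = part V a.
Proof. by apply: eq_bigr => t tV; rewrite res_part tV. Qed.

Lemma part_adjoint (V : {set T}) : self_adjoint dot (part V).
Proof.
move=> a b; rewrite linear_sumlz linear_sumr.
by apply: eq_bigr => t _; apply: (res_adjoint Eres).
Qed.

Lemma rnorm2_part (V : {set T}) a :
  rnorm (part V a) ^+ 2 = \sum_(t in V) rdot dot (E t a) (E t a).
Proof.
rewrite (rnorm2 dotE) /rdot -part_adjoint part_idem -/(rdot _ _ _) rdot_suml.
by apply: eq_bigr => t _; rewrite /rdot dot_res.
Qed.

Lemma rdot_res_sum a : \sum_t rdot dot (E t a) (E t a) = rdot dot a a.
Proof.
under eq_bigr do rewrite /rdot -dot_res.
by rewrite -rdot_suml (res_sum Eres).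
Qed.

Lemma part_projection (V : {set T}) : projection dot (part V).
Proof.
split; last exact: part_adjoint.
  split; first exact: linear_sum_maps (res_linear Eres).
  exists 1 => a; rewrite mul1r -ler_sqr ?nnegrE ?rnorm_ge0 //.
  rewrite rnorm2_part (rnorm2 dotE).
  rewrite -(rdot_res_sum a) [leRHS](bigID (mem V)) /= lerDl sumr_ge0 // => t _.
  exact: rdot_ge0.
by apply/funext => a; apply: part_idem.
Qed.

(* [t <= u] in this preorder iff operators leaving the members of [s] invariant
   may have a nonzero [(u, t)] entry with respect to [E]. *)
Definition invariance_order (s : seq (H -> H)) (t u : T) : bool :=
  `[< forall P, P \in s -> (forall a, P (E t a) = E t a) ->
                forall a, P (E u a) = E u a >].

Variables (L : set (H -> H)) (s : seq (H -> H)).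
Hypothesis sL : forall P, P \in s -> L P.
Hypothesis EL : forall P t a, L P -> P (E t a) = E t (P a).
Hypothesis Es : forall P t, P \in s ->
  (forall a, P (E t a) = E t a) \/ (forall a, P (E t a) = 0).

(** The neighbours of [U] form the up-set it generates, and an operator in [Alg L] maps the range of
    [E t] into the sum of the ranges of [E u] with [t <= u]. *)
Lemma part_in_Lat (U : {set T}) :
  Lat dot (Alg L) (part (neighbours (invariance_order s) U)).
Proof.
split; first exact: part_projection.
move=> A [[Alin _] Ainv]; apply/leaves_invariantP => a.
set V := neighbours _ U.
have V_inv t z : t \in V -> part V (A (E t z)) = A (E t z).
  move=> /neighboursP[u uU ut]; rewrite -[RHS](res_sum Eres).
  rewrite [RHS](bigID (mem V)) /=.
  rewrite [X in _ + X]big1 ?addr0 // => v vV.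
  (* Some [P] in [s] then fixes the range of [E t] and kills that of [E v], whence
     [E_v A E_t = E_v P A P E_t = 0]. *)
  have /asboolPn : ~~ invariance_order s t v.
    apply: contra vV => /asboolP tv; apply/neighboursP; exists u => //.
    move/asboolP: ut => ut; apply/asboolP => P Ps Pu.
    by apply: tv => //; apply: ut.
  move=> /existsNP[P /not_implyP[Ps /not_implyP[Pt Pv]]].
  have {}Pv : forall a, P (E v a) = 0 by case: (Es v Ps).
  have /leaves_invariantP AP := Ainv P (sL Ps).
  by rewrite -Pt -AP -(EL _ _ (sL Ps)) Pv.
rewrite {2 3}/part !(linear_map_sum _ _ Alin).
have [[Vlin _] _ _] := part_projection V.
rewrite (linear_map_sum _ _ Vlin).
by apply: eq_bigr => t tV; apply: V_inv.
Qed.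

End Resolution.

(** * The pseudo-integral contraction of a flow *)

Lemma finite_contraction (L : set (H -> H)) (s : seq (H -> H))
    (x y : H) (c : R) :
  (forall P, L P -> projection dot P) ->
  (forall P Q, L P -> L Q -> P \o Q = Q \o P) ->
  (forall P, P \in s -> L P) ->
  (forall P, Lat dot (Alg L) P ->
     c <= rnorm (x - P x) ^+ 2 + rnorm (P y) ^+ 2) ->
  exists A, [/\ contraction A, c <= rdot dot (A x) y &
                forall P, P \in s -> leaves_invariant A P].
Proof.
move=> Lproj Lcomm sL c_le.
have [T [E [Eres EL Es]]] := joint_resolution Lproj Lcomm sL.
pose a t := rdot dot (E t x) (E t x); pose b t := rdot dot (E t y) (E t y).
have a0 t : 0 <= a t by apply: rdot_ge0.
have b0 t : 0 <= b t by apply: rdot_ge0.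
have [|sg [sg0 sge sga sgb sgc]] :=
    @transport_min_cut R T T (invariance_order E s) a b c a0 b0.
  move=> U; apply: le_trans (c_le _ (part_in_Lat Eres sL EL Es U)) _.
  rewrite (partC Eres) !(rnorm2_part Eres) lerD2r.
  (* Reflexivity of the preorder puts [U] inside [V], so the supply outside [V] is at most the
     supply outside [U]. *)
  set V := neighbours _ U; rewrite [leRHS](bigID (mem (~: V))) /=.
  rewrite [X in _ <= X + _](_ : _ = \sum_(t in ~: V) a t).
    by rewrite lerDl sumr_ge0.
  apply: eq_bigl => t; rewrite !finset.in_setC andbC.
  case: (boolP (t \in U)) => [tU|]; last by rewrite andbT.
  rewrite andbF; apply/esym/negbF/neighboursP; exists t => //.
  exact/asboolP.
have sga' t u : sg t u <= a t.
  by apply: le_trans (sga t); rewrite (bigD1 u) //= lerDl sumr_ge0.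
have sgb' t u : sg t u <= b u.
  by apply: le_trans (sgb u); rewrite (bigD1 t) //= lerDl sumr_ge0.
(* If [a t] or [b u] vanishes, so does [sg t u]; the convention that the inverse of 0 is 0 is
   harmless. *)
pose A z := \sum_t \sum_u ((sg t u / (a t * b u))%:C * dot z (E t x)) *: E u y.
have Alin : linear A.
  apply: linear_sum_maps => t; apply: linear_sum_maps => u k z z'.
  by rewrite dotDl dotZl mulrDr scalerDl scalerA mulrCA.
have A_dot z g : rdot dot (A z) g = \sum_t \sum_u
    sg t u * ((a t)^-1 * (b u)^-1 * complex.Re (dot z (E t x) * dot (E u y) g)).
  rewrite rdot_suml; apply: eq_bigr => t _.
  rewrite rdot_suml; apply: eq_bigr => u _.
  rewrite -scalerA rdotZl /rdot dotZl mulrA; congr (_ * _).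
  by rewrite invfM mulrA.
have bound (p r d n : R) : 0 <= p -> 0 <= r -> 0 <= n -> 0 <= d ->
    p <= r -> d <= n * r -> p * (r^-1 ^+ 2 * d) <= n.
  move=> p0 r0 n0 d0 pr dn; have [r1|r1] := eqVneq r 0.
    by rewrite r1 invr0 expr0n /= mul0r mulr0.
  have {r0 r1}r0 : 0 < r by rewrite lt_def r1.
  apply: (@le_trans _ _ (r * (r^-1 ^+ 2 * (n * r)))).
    apply: ler_pM => //; first by rewrite mulr_ge0 ?sqr_ge0.
    by rewrite ler_wpM2l ?sqr_ge0.
  by have -> : r * (r^-1 ^+ 2 * (n * r)) = n by field; rewrite gt_eqF.
(* [ReM_le] with weights [1 / a t] and [1 / b u] separates the factors in [t] and [u]; then the
   marginals of [sg] and Cauchy-Schwarz on each range apply. The case [g = A z] gives the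
   contraction property. *)
have A_le z g : rdot dot (A z) g <= (rdot dot z z + rdot dot g g) / 2.
  rewrite A_dot.
  apply: (@le_trans _ _ (\sum_t \sum_u
    (sg t u * ((a t)^-1 ^+ 2 * abs2 (dot z (E t x)))
     + sg t u * ((b u)^-1 ^+ 2 * abs2 (dot (E u y) g))) / 2)).
    apply: ler_sum => t _; apply: ler_sum => u _.
    by rewrite -mulrDr -[leRHS]mulrA ler_wpM2l // ReM_le.
  under eq_bigr do rewrite -mulr_suml big_split /=.
  rewrite -mulr_suml big_split /= ler_pM2r ?invr_gt0 // lerD //.
    rewrite -(rdot_res_sum Eres z); apply: ler_sum => t _.
    rewrite -mulr_suml bound ?rdot_ge0 ?abs2_ge0 ?sumr_ge0 //.
    by rewrite (dot_res_swap Eres); apply: dot_CauchySchwarz.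
  rewrite exchange_big /= -(rdot_res_sum Eres g); apply: ler_sum => u _.
  rewrite -mulr_suml bound ?rdot_ge0 ?abs2_ge0 ?sumr_ge0 //.
  by rewrite (dot_res Eres) mulrC; apply: dot_CauchySchwarz.
exists A; split.
- split=> // z; rewrite -ler_sqr ?nnegrE ?rnorm_ge0 // !(rnorm2 dotE).
  by have := A_le z (A z); lra.
- apply: le_trans sgc _; rewrite A_dot.
  apply: ler_sum => t _; apply: ler_sum => u _.
  have [->|sg1] := eqVneq (sg t u) 0; first by rewrite mul0r.
  have sg_gt0 : 0 < sg t u by rewrite lt_def sg1 sg0.
  have at_gt0 := lt_le_trans sg_gt0 (sga' t u).
  have bu_gt0 := lt_le_trans sg_gt0 (sgb' t u).
  rewrite (dot_res_swap Eres t x) (dot_res Eres u y) !(dotxx dotE) /=.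
  rewrite -/(a t) -/(b u).
  by rewrite mulr0 subr0 -invfM mulVf ?mulr1 // mulf_neq0 ?gt_eqF.
move=> P Ps; have LP := sL P Ps; have [[Plin _] _ Padj] := Lproj P LP.
apply/leaves_invariantP => z; rewrite /A (linear_map_sum _ _ Plin).
apply: eq_bigr => t _; rewrite (linear_map_sum _ _ Plin); apply: eq_bigr => u _.
rewrite (linear_mapZ Plin).
have [->|sg1] := eqVneq (sg t u) 0; first by rewrite !mul0r !scale0r.
have /asboolP tu := sge t u sg1.
(* If [P] fixes the range of [E t], it fixes [E u y] as [t <= u]; if it kills that range, the
   coefficient [(P z, E_t x) = (z, P E_t x)] vanishes. *)
have [Pt|Pt] := Es P t Ps; first by rewrite (tu P Ps Pt).
by rewrite Padj Pt dotC dot0l conjc0 mulr0 !scale0r.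
Qed.
End FiniteStep.

(** * Contractions and the operator norm *)

Section OperatorNorm.
Variables (R : realType) (H : completeNormedModType R[i]).

Lemma rnormZ (k : R) (a : H) : 0 <= k -> rnorm (k%:C *: a) = k * rnorm a.
Proof.
move=> k0; have := normrZ (k%:C : R[i]) a; rewrite !rnormC ger0_norm ?lecR //.
by rewrite -rmorphM /= => -[].
Qed.

Lemma opnorm_contraction (A : H -> H) : contraction A -> opnorm A <= 1.
Proof.
move=> [_ A_le]; apply: ge_sup.
  by exists (rnorm (A 0)), 0 => //=; rewrite /rnorm normr0.
by move=> _ [a /= a1 <-]; apply: le_trans (A_le a) a1.
Qed.

(** Rescale to the unit ball; boundedness of [A] makes the supremum [opnorm A] a true upper
    bound. *)
Lemma contraction_opnorm (A : H -> H) :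
  bounded_op A -> opnorm A <= 1 -> contraction A.
Proof.
move=> [Alin [M AM]] A1; split=> // a.
have [a0|a0] := eqVneq (rnorm a) 0.
  by apply: le_trans (AM a) _; rewrite a0 mulr0.
have a_gt0 : 0 < rnorm a by rewrite lt_def a0 rnorm_ge0.
have inv_ge0 : 0 <= (rnorm a)^-1 by rewrite invr_ge0 rnorm_ge0.
suff : (rnorm a)^-1 * rnorm (A a) <= 1 by rewrite ler_pdivrMl // mulr1.
rewrite -(rnormZ _ inv_ge0) -(linear_mapZ Alin); apply: le_trans A1.
apply: ub_le_sup; last first.
  by exists ((rnorm a)^-1%:C *: a) => //=; rewrite rnormZ // mulVf.
exists `|M| => _ [b /= b1 <-]; apply: le_trans (AM b) _.
apply: le_trans (ler_norm _) _; rewrite normrM ler_piMr //.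
by rewrite ger0_norm ?rnorm_ge0.
Qed.

End OperatorNorm.

(** * Property (V) of CSL algebras *)

Theorem theorem2p6 (R : realType) (H : completeNormedModType R[i])
    (dot : {dot H for @Num.conj R[i]}) (dotE : inner_product_norm dot)
    (L : set (H -> H)) (CSL_L : CSL dot L) :
  property_V dot (Alg L).
Proof.
move=> x y; set c := inf _.
have [[[L_proj _ _] _] L_comm] := CSL_L.
(* Every operator leaves the identity invariant, so adjoining it preserves [Alg] and makes the
   family indexing the ultrafilter nonempty. *)
pose L' := [set idfun] `|` L.
have AlgL' A : Alg L A <-> Alg L' A.
  split=> -[Ab AL]; split=> // P; last by move=> LP; apply: AL; right.
  move=> [->|LP]; last exact: AL.
  exact/leaves_invariantP.
have c_le P : Lat dot (Alg L') P ->
    c <= rnorm (x - P x) ^+ 2 + rnorm (P y) ^+ 2.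
  move=> [Pp PL']; apply: ge_inf.
    by exists 0 => _ [Q _ <-]; rewrite addr_ge0 ?sqr_ge0.
  by exists P => //; split=> // A /AlgL'; apply: PL'.
have id_proj : projection dot idfun.
  by split=> //; split=> //; exists 1 => a; rewrite mul1r.
have L'_proj P : L' P -> projection dot P by move=> [->|/L_proj].
have L'_comm P Q : L' P -> L' Q -> P \o Q = Q \o P.
  by move=> [->|LP] [->|LQ] //; apply: L_comm.
have [|||A [Ac cA /AlgL' AL]] := @contraction_in_Alg R H dot dotE L' x y c.
- by move=> P /L'_proj[[]].
- by left.
- by move=> s sL'; apply: (finite_contraction dotE L'_proj L'_comm sL' c_le).
apply: le_trans cA _.
apply: (@le_trans _ _ (complex.Re `|dot (A x) y|)).
  have := normc_ge_Re (dot (A x) y); rewrite normc_def lecR.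
  exact: le_trans (ler_norm _).
(* The supremum dominates the value at [A] because the set is bounded above, by [|x| |y|]. *)
apply: ub_le_sup.
  exists (rnorm x * rnorm y) => _ [T [[Tb _] T1] <-].
  apply: le_trans (normr_dot_le dotE _ _) _; rewrite ler_wpM2r ?rnorm_ge0 //.
  exact: (contraction_opnorm Tb T1).2.
by exists A => //; split=> //; apply: opnorm_contraction.
Qed.
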